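(* Let $G=(V,E)$ be a signed graph which is chordal as a non-signed graph. Then $G$ is signed-eliminable if and only if both of the following conditions hold: (C2) For every $\sigma\in\{+,-\}$ and every four distinct vertices $u,v,w,x$ of $G$ with $uv\in E_\sigma$, $vw\in E_{-\sigma}$, $wx\in E_\sigma$, we have either ($uw\in E_\sigma$ and $ux\in E_\sigma$) or ($ux\in E_\sigma$ and $vx\in E_\sigma$). (C3) $G$ contains no mountain and no hill as an induced subgraph.
   Context: All graphs are finite, simple and undirected. A signed graph is a graph $G=(V,E)$ together with a partition $E=E_+\sqcup E_-$ (either part may be empty); $-\sigma$ denotes the sign opposite to $\sigma\in\{+,-\}$. Induced subgraphs of a signed graph inherit the signs. A graph is chordal if it has no induced cycle of length at least four. An ordering on $G$ is a bijection $\nu:V\to\{1,\dots,|V|\}$. It is a signed elimination ordering (SEO) if for every triple $(u,v,w)$ of distinct vertices with $\nu(u)<\nu(w)>\nu(v)$ and each $\sigma\in\{+,-\}$: (E1) if $uw,wv\in E_\sigma$ then $uv\in E_\sigma$; (E2) if $uv\in E_\sigma$ and $vw\in E_{-\sigma}$ then $uw\in E_\sigma$. $G$ is signed-eliminable if it admits a SEO. A mountain is a signed graph for which there are $\sigma\in\{+,-\}$ and an enumeration $(v_1,\dots,v_n;w)$ of its (distinct) vertices, $n\ge 3$, such that $v_iv_{i+1}\in E_{-\sigma}$ for $1\le i\le n-1$, $wv_i\in E_\sigma$ for $2\le i\le n-1$, and no other pair of vertices is joined by an edge. A hill is a signed graph for which there are $\sigma\in\{+,-\}$ and an enumeration $(v_1,\dots,v_n;w_1,w_2)$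 of its (distinct) vertices, $n\ge 2$, such that $v_iv_{i+1}\in E_{-\sigma}$ for $1\le i\le n-1$, $w_1w_2\in E_\sigma$, $w_1v_i\in E_\sigma$ for $1\le i\le n-1$, $w_2v_i\in E_\sigma$ for $2\le i\le n$, and no other pair of vertices is joined by an edge. *)

(* Defs.v *)
From mathcomp Require Import all_boot.

Set Implicit Arguments.
Unset Strict Implicit.
Unset Printing Implicit Defensive.

(* true is the sign +, false is the sign -, and ~~ s is the opposite of s. *)
Definition sign := bool.

Record graph (V : finType) := Graph {
  adj : rel V;
  adj_sym : symmetric adj;
  adj_irr : irreflexive adj
}.

(* The edge set E is not stored: it is the disjoint union of the E_s, see
   underlying. *)
Record signed_graph (V : finType) := SignedGraph {
  sedge : sign -> rel V;
  sedge_sym : forall s, symmetric (sedge s);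
  sedge_irr : forall s, irreflexive (sedge s);
  sedge_disj : forall x y, ~~ (sedge true x y && sedge false x y)
}.

Section Underlying.
Variables (V : finType) (G : signed_graph V).

Let uadj : rel V := [rel x y | sedge G true x y || sedge G false x y].

Fact uadj_sym : symmetric uadj.
Proof. by move=> x y; rewrite /uadj /= ![sedge G _ x y]sedge_sym. Qed.

Fact uadj_irr : irreflexive uadj.
Proof. by move=> x; rewrite /uadj /= !sedge_irr. Qed.

Definition underlying : graph V := Graph uadj_sym uadj_irr.

End Underlying.

Section Induced.
Variables (V : finType) (S : {set V}).

Let T : finType := {x : V | x \in S}.

Definition induced_graph (H : graph V) : graph T :=
  @Graph T (fun x y => adj H (val x) (val y))
    (fun x y => adj_sym H (val x) (val y))
    (fun x => adj_irr H (val x)).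

Definition induced (G : signed_graph V) : signed_graph T :=
  @SignedGraph T (fun s x y => sedge G s (val x) (val y))
    (fun s x y => sedge_sym G s (val x) (val y))
    (fun s x => sedge_irr G s (val x))
    (fun x y => sedge_disj G (val x) (val y)).

End Induced.

(* Meaningful for n >= 3; ordS is the successor modulo n. *)
Definition is_cycle (n : nat) (T : finType) (H : graph T) : Prop :=
  exists2 v : 'I_n -> T, bijective v &
    forall i j, adj H (v i) (v j) = (j == ordS i) || (i == ordS j).

Definition chordal (V : finType) (H : graph V) : Prop :=
  forall (n : nat) (S : {set V}), 4 <= n -> ~ is_cycle n (induced_graph S H).

Definition is_SEO (V : finType) (G : signed_graph V) (nu : V -> 'I_#|V|) :
    Prop :=
  bijective nu /\
  forall u v w : V, uniq [:: u; v; w] -> nu u < nu w -> nu v < nu w ->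
  forall s : sign,
    (sedge G s u w -> sedge G s w v -> sedge G s u v) /\
    (sedge G s u v -> sedge G (~~ s) v w -> sedge G s u w).

Definition signed_eliminable (V : finType) (G : signed_graph V) : Prop :=
  exists nu : V -> 'I_#|V|, is_SEO G nu.

(* The vertices v_1, ..., v_n of the paths below are v 0, ..., v (n - 1), so
   that v_(i+1) is joined to w iff 2 <= i + 1 <= n - 1, i.e. iff
   0 < i and i + 1 < n.  The equations determine all adjacencies, hence also
   the non-adjacencies. *)
Definition is_mountain (T : finType) (H : signed_graph T) : Prop :=
  exists (s : sign) (n : nat) (v : 'I_n -> T) (w : T),
  [/\ 3 <= n,
      injective v /\ (forall i, v i != w),
      (forall x : T, x = w \/ exists i, x = v i),
      (forall i j, sedge H (~~ s) (v i) (v j) = (i.+1 == j) || (j.+1 == i)) /\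
      (forall i j, sedge H s (v i) (v j) = false) &
      (forall i, sedge H s w (v i) = (0 < i) && (i.+1 < n)) /\
      (forall i, sedge H (~~ s) w (v i) = false)].

Definition is_hill (T : finType) (H : signed_graph T) : Prop :=
  exists (s : sign) (n : nat) (v : 'I_n -> T) (w1 w2 : T),
  [/\ 2 <= n,
      [/\ injective v, (forall i, v i != w1), (forall i, v i != w2) &
          w1 != w2],
      (forall x : T, x = w1 \/ x = w2 \/ exists i, x = v i),
      (forall i j, sedge H (~~ s) (v i) (v j) = (i.+1 == j) || (j.+1 == i)) /\
      (forall i j, sedge H s (v i) (v j) = false) &
      [/\ sedge H s w1 w2,
          (forall i, sedge H s w1 (v i) = (i.+1 < n)),
          (forall i, sedge H s w2 (v i) = (0 < i)) &
          (forall i, sedge H (~~ s) w1 (v i) = false /\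
                     sedge H (~~ s) w2 (v i) = false)]].

Definition cond_C2 (V : finType) (G : signed_graph V) : Prop :=
  forall (s : sign) (u v w x : V), uniq [:: u; v; w; x] ->
    sedge G s u v -> sedge G (~~ s) v w -> sedge G s w x ->
    (sedge G s u w /\ sedge G s u x) \/ (sedge G s u x /\ sedge G s v x).

Definition cond_C3 (V : finType) (G : signed_graph V) : Prop :=
  forall S : {set V}, ~ is_mountain (induced S G) /\ ~ is_hill (induced S G).

(* Main.v *)
Require Import Defs.
From mathcomp Require Import all_boot.
From mathcomp Require Import zify.

Set Implicit Arguments.
Unset Strict Implicit.
Unset Printing Implicit Defensive.

(* A SEO exists iff every nonempty vertex set A contains a vertex that may come
   last in A; the last vertex of a SEO refutes C2-violations, mountains and
   hills.  Conversely, let N_s(v) be the s-neighbourhood of v in A.  By (C2),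
   the ends v, w of an edge of sign -s have nested s-neighbourhoods, the smaller
   one being s-complete to the larger one.  Put an arc from v to u when vu is an
   edge of sign s and N_(-s)(v) is included in N_(-s)(u).  Closed walks of arcs
   are monochromatic, so a terminal strongly connected component T has arcs of
   one sign -s only, and N_s is constant on T.  Two nonadjacent vertices of the
   (-s)-boundary of T, joined by an induced path through T, would span a mountain
   or a hill with one or two vertices of this common N_s.  Hence the boundary is
   a clique, and by Dirac's argument T contains a vertex simplicial in T and its
   boundary; that vertex may come last in A. *)

(** * Induced paths extracted from walks *)

Section InducedPaths.
Variables (V : finType) (e : rel V).
Hypotheses (e_sym : symmetric e) (e_irr : irreflexive e).

Fixpoint induced_path (x : V) (s : seq V) : bool :=
  if s is y :: s' then
    [&& e x y, all (fun z => (z != x) && ~~ e x z) s' & induced_path y s']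
  else true.

Lemma induced_path_uniq x s : induced_path x s -> uniq (x :: s).
Proof.
elim: s x => //= y s IHs x /and3P[exy xs ys].
have /= -> := IHs _ ys; rewrite andbT in_cons negb_or.
apply/andP; split.
  by apply/eqP => xy; rewrite xy e_irr in exy.
by apply/negP => /(allP xs); rewrite eqxx.
Qed.

Lemma induced_path_nth d x s i j : induced_path x s -> i <= size s -> j <= size s ->
  e (nth d (x :: s) i) (nth d (x :: s) j) = (i.+1 == j) || (j.+1 == i).
Proof.
move=> xs; wlog ij : i j / i <= j.
  move=> W ile jle; case: (leqP i j) => [ij | /ltnW ji]; first exact: W.
  by rewrite e_sym orbC W.
elim: s x i j ij xs => [|y s IHs] x i j ij /=.
  by move=> _; move: i j ij => [|i] [|j] //= _ _ _; rewrite e_irr.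
case/and3P=> exy xs ys.
case: i j ij => [|i] [|j] //= ij ile jle.
- case: j jle {ij} => [|j] //= jle.
  by have /(allP xs)/andP[_ /negbTE ->] : nth d s j \in s by rewrite mem_nth.
- by rewrite IHs // !eqSS.
Qed.

Lemma induced_path_suffix (P : pred V) y s : induced_path y s -> has P (y :: s) ->
  exists z s', [/\ P z, all (predC P) s', induced_path z s',
    last z s' = last y s & {subset z :: s' <= y :: s}].
Proof.
elim: s y => [|z s IHs] y /=.
  by rewrite orbF => _ Py; exists y, [::]; split.
case/and3P=> eyz ys zs hasP; case: (boolP (has P (z :: s))) => [|noP].
  case/(IHs _ zs) => t [s' [Pt Ps' ts' l sub]]; exists t, s'; split=> //.
  by move=> u /sub us; rewrite in_cons us orbT.
exists y, (z :: s); split=> //; last by rewrite /= eyz ys.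
- by move: hasP; rewrite -/(has P (z :: s)) (negbTE noP) orbF.
- by rewrite all_predC.
Qed.

Lemma path_induced_path x s : path e x s ->
  exists s', [/\ induced_path x s', last x s' = last x s & {subset s' <= s}].
Proof.
elim: s x => [|y s IHs] x /=; first by exists [::].
case/andP=> exy /IHs[s1 [ys1 l1 sub1]].
(* Jump from [x] to the last vertex that equals [x] or is adjacent to it; no later vertex can then
   repeat [x] or give a chord. *)
have hasP : has [pred z | (z == x) || e x z] (y :: s1) by rewrite /= exy orbT.
have [z [s2 [/= Pz Ps2 zs2 l2 sub2]]] := induced_path_suffix ys1 hasP.
have sub: {subset z :: s2 <= y :: s}.
  move=> u /sub2; rewrite !in_cons => /predU1P[-> | /sub1 ->]; first by rewrite eqxx.
  by rewrite orbT.
case/predU1P: Pz => [zx | exz].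
  subst z; exists s2; split; rewrite -?l1 //.
  by move=> u us2; apply: sub; rewrite in_cons us2 orbT.
exists (z :: s2); split; rewrite /= ?l2 //.
rewrite exz zs2 andbT; apply: sub_all Ps2 => u /=.
by rewrite negb_or.
Qed.

(** Shortcutting a walk from [p] through [T] to [q] creates no new vertices, and by uniqueness the
    inner ones differ from [q], so they stay in [T]. *)
Lemma joining_induced_path (T : {set V}) p q tp tq :
    p != q -> tp \in T -> q \notin T -> e p tp -> e tq q ->
    connect [rel u v | [&& u \in T, v \in T & e u v]] tp tq ->
  exists2 m, induced_path p (rcons m q) & {subset m <= T}.
Proof.
move=> pq tpT qT ep eq /connectP[s tps ltq].
have sT : {subset s <= T}.
  elim: s (tp) tps {ltq ep tpT} => //= y s IHs x /andP[/and3P[xT yT _] ys] u.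
  by rewrite in_cons => /predU1P[-> // | us]; apply: (IHs y).
have pth : path e p (tp :: rcons s q).
  rewrite /= ep rcons_path -ltq eq andbT.
  by apply: sub_path tps => x y /and3P[].
have [s' [ps' l sub]] := path_induced_path pth.
case/lastP: s' ps' l sub => [|m z] pm.
  by rewrite /= last_rcons => pq'; rewrite pq' eqxx in pq.
rewrite /= last_rcons /= last_rcons => zq; subst z => sub; exists m => // u um.
have := induced_path_uniq pm; rewrite /= rcons_uniq => /and3P[_ qm _].
have: u \in tp :: rcons s q by apply: sub; rewrite mem_rcons in_cons um orbT.
rewrite in_cons mem_rcons in_cons => /or3P[/eqP-> // | /eqP uq | /sT //].
by rewrite uq (negbTE qm) in um.
Qed.

End InducedPaths.

(** * Simplicial vertices of chordal graphs *)

Section Chordal.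
Variables (V : finType) (H : graph V).
Hypothesis chordalH : chordal H.

Let adjs := adj_sym H.
Let adji := adj_irr H.

(** The vertex [a] closes the path into the induced cycle [a :: x :: s], whose length is at least 4
    because [2 <= size s]. *)
Lemma chordal_no_cycle a x s : 2 <= size s -> induced_path (adj H) x s ->
  a \notin x :: s -> adj H a x -> adj H a (last x s) ->
  (forall z, z \in x :: s -> adj H a z -> z = x \/ z = last x s) -> False.
Proof.
move=> s2 xs aNs ax al aN.
have us := induced_path_uniq adji xs.
pose c := a :: x :: s; pose n := size c.
have uc : uniq c by rewrite /c [uniq _]/= aNs.
pose S := [set z in c].
have vS (i : 'I_n) : nth a c i \in S by rewrite inE mem_nth.
pose v (i : 'I_n) : {z | z \in S} := exist _ (nth a c i) (vS i).
have v_inj : injective v.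
  move=> i j /(congr1 val) /= /eqP; rewrite nth_uniq // => /eqP ij.
  exact: val_inj.
have a0 j : 0 < j -> j < n ->
    adj H a (nth a c j) = (j == 1) || (j == n.-1).
  case: j => // j _; rewrite /n /= !ltnS eqSS => js.
  apply/idP/orP => [/aN [|E|E] | [/eqP-> // | ]].
  - by rewrite mem_nth.
  - by left; rewrite -(nth_uniq a (s := x :: s)) //= E.
  - right; rewrite eqSS -(nth_uniq a (s := x :: s)) //= E.
    by rewrite -[size s]/((size (x :: s)).-1) nth_last.
  - by rewrite eqSS => /eqP->; rewrite -[size s]/((size (x :: s)).-1) nth_last.
apply: (@chordalH n S); first by rewrite /n /=.
exists v.
  apply: inj_card_bij => //; rewrite card_ord card_sig.
  rewrite (eq_card (B := mem c)); last by move=> z; rewrite !inE.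
  by rewrite (card_uniqP uc).
(* The cyclic successor is written as a case split, which leaves only linear arithmetic. *)
have cyc (i j : 'I_n) : (j == ordS i) =
    (j == (if i == n.-1 :> nat then 0 else i.+1) :> nat).
  rewrite -val_eqE [val (ordS i)]/=; have := ltn_ord i.
  have [-> _ | ne lt] := eqVneq (i : nat) n.-1; first by rewrite [X in _ %% X](_ : n = n.-1.+1) // modnn.
  by rewrite modn_small //; rewrite /n /= in ne lt *; lia.
move=> i j; rewrite !cyc /=.
case: i j => [[|i] hi] [[|j] hj]; rewrite -/n /= in hi hj *.
- by rewrite adji.
- by rewrite -[nth a _ j]/(nth a c j.+1) a0 // /n /=; case: ifP; lia.
- by rewrite adjs -[nth a _ i]/(nth a c i.+1) a0 // /n /=; case: ifP; lia.
- rewrite (induced_path_nth adjs adji a xs) //; rewrite /n /= in hi hj *.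
  by do 2![case: ifP]; lia.
Qed.

(* Dirac: a connected component C of W \ N[a] has a clique as neighbourhood, so
   one can recurse on C together with this clique. *)
Lemma chordal_simplicial (W Q : {set V}) :
  Q \proper W -> {in Q &, forall x y, x != y -> adj H x y} ->
  exists2 v, v \in W :\: Q &
    {in W &, forall x y, adj H v x -> adj H v y -> x != y -> adj H x y}.
Proof.
have [n] := ubnP #|W|; elim: n => // n IHn in W Q * => /ltnSE Wn QW clQ.
have [QsW [w0 w0W w0Q]] := properP QW.
pose univ a := [forall x in W, (x == a) || adj H a x].
(* A vertex of [Q] not universal in [W] can serve as [a], since [Q] is a clique. If there is none,
   all of [Q] is universal and any non-universal vertex of [W] serves. As [Q] lies in N[a], a vertex
   found outside N[a] is automatically outside [Q]. *)
have [[a [aW aU Qa]] | allU] : (exists a, [/\ a \in W, ~~ univ a &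
    {in Q, forall x, (x == a) || adj H a x}]) \/ {in W, forall a, univ a}.
- case: (boolP [forall a in Q, univ a]) => [/forall_inP QU | ].
    case: (boolP [forall a in W, univ a]) => [/forall_inP | ]; first by right.
    case/forall_inPn => a aW aU; left; exists a; split=> // x xQ.
    have /forall_inP/(_ a aW) := QU x xQ.
    by rewrite eq_sym adjs.
  case/forall_inPn => a aQ aU; left; exists a; split=> //.
    exact: (subsetP QsW).
  by move=> x xQ; case: eqVneq => //= xa; rewrite adjs clQ // eq_sym.
- have /forall_inPn[c0 c0W] := aU; rewrite negb_or => /andP[c0a ac0].
  pose B := [set c in W | (c != a) && ~~ adj H a c].
  pose r := [rel u v | [&& u \in B, v \in B & adj H u v]].
  have r_sym : connect_sym r.
    by apply: sym_connect_sym => x y /=; rewrite andbCA adjs.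
  pose C := [set c | connect r c0 c].
  have c0B : c0 \in B by rewrite inE c0W c0a.
  have c0C : c0 \in C by rewrite inE connect0.
  have CB : {subset C <= B}.
    move=> c; rewrite inE => /connectP[s + ->].
    elim: s (c0) c0B {ac0 c0a c0W c0C C} => //= y s IHs x _ /andP[/and3P[_ yB _]].
    exact: IHs.
  pose S := [set x in W :\: C | [exists c in C, adj H x c]].
  have Sprop x : x \in S -> [/\ x \in W, x \notin B, adj H a x &
      exists2 c, c \in C & adj H x c].
    rewrite {1}/S inE in_setD => /andP[/andP[xC xW] /exists_inP[c cC xc]].
    have cB := CB c cC.
    have xB : x \notin B.
      apply: contra xC => xB; rewrite inE; rewrite inE in cC; apply: connect_trans cC _.
      by apply: connect1; rewrite /= cB xB adjs.
    have xa : x != a.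
      by apply: contraTneq xc => ->; move: cB; rewrite inE => /and3P[].
    split=> //; last by exists c.
    by move: xB; rewrite inE xW xa /= negbK.
  have clS : {in S &, forall x y, x != y -> adj H x y}.
    move=> x y xS yS xy.
    have [xW xB ax [cx cxC xcx]] := Sprop x xS.
    have [yW yB ay [cy cyC ycy]] := Sprop y yS.
    (* Nonadjacent [x] and [y] are joined by an induced path whose inner vertices lie in [B], unseen
       by [a]; with [a] it forms a forbidden cycle. *)
    apply: contraT => nxy; exfalso.
    have con : connect r cx cy.
      rewrite !inE in cxC cyC; apply: connect_trans cyC.
      by rewrite r_sym.
    have ycy' : adj H cy y by rewrite adjs.
    have [m pm mB] := joining_induced_path adji xy (CB _ cxC) yB xcx ycy' con.
    have m0 : 0 < size m by case: m pm {mB} => //=; rewrite (negbTE nxy).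
    have mx z : z \in x :: rcons m y -> [\/ z = x, z = y | z \in B].
      rewrite in_cons mem_rcons in_cons => /or3P[/eqP | /eqP | /mB]; by constructor.
    apply: (@chordal_no_cycle a x (rcons m y)); rewrite ?last_rcons ?size_rcons //.
      apply/negP => /mx[E|E|]; last by rewrite inE eqxx andbF.
        by rewrite -E adji in ax.
      by rewrite -E adji in ay.
    move=> z /mx[->|->|]; [by left | by right |].
    by rewrite inE => /and3P[_ _ /negbTE->].
  have W'W : C :|: S \proper W.
    apply/properP; split.
      apply/subsetP => x; rewrite inE => /orP[/CB | /Sprop[]//].
      by rewrite inE => /andP[].
    exists a => //; apply/negP; rewrite inE => /orP[/CB | /Sprop[_ _]].
      by rewrite inE eqxx andbF.
    by rewrite adji.
  have c0S : c0 \notin S by rewrite !inE connect0.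
  have [||//|v vCS vsim] := IHn (C :|: S) S.
  - exact: leq_trans (proper_card W'W) Wn.
  - apply/properP; split; first exact: subsetUr.
    by exists c0; rewrite // inE c0C.
  have vC : v \in C by move: vCS; rewrite inE in_setU => /andP[/negbTE->]; rewrite orbF.
  have vB := CB v vC.
  exists v.
    move: vB; rewrite !inE => /and3P[vW va av]; rewrite vW andbT.
    by apply/negP => /Qa; rewrite (negbTE va) (negbTE av).
  have nbv x : x \in W -> adj H v x -> x \in C :|: S.
    move=> xW vx; rewrite inE; case: (boolP (x \in C)) => //= xC.
    by rewrite !inE -[connect _ _ _]in_set xC xW /=; apply/exists_inP; exists v; rewrite // adjs.
  by move=> x y xW yW vx vy; apply: vsim; rewrite ?nbv.
- exists w0; first by rewrite inE w0Q w0W.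
  move=> x y xW yW _ _ xy.
  by have /forall_inP/(_ y yW) := allU x xW; rewrite eq_sym (negbTE xy).
Qed.

End Chordal.

(** * Signed graphs: vertices that may come last *)

Section Signed.
Variables (V : finType) (G : signed_graph V).

Local Notation E := (sedge G).

Lemma sedge_disjF s u v : E s u v -> E (~~ s) u v = false.
Proof.
by have := sedge_disj G u v; case: s => /= + uv; rewrite uv ?andbT => /negbTE.
Qed.

Lemma adj_underlyingE s u v : adj (underlying G) u v = E s u v || E (~~ s) u v.
Proof. by case: s => //=; rewrite orbC. Qed.

(** (E1) and (E2) for [w] as last vertex of [A]. Distinctness is stated only where it does not
    follow from the edges and their signs: in (E2), [u = w] would give one edge both signs. *)
Definition signed_simplicial (A : {set V}) (w : V) : Prop :=
  forall s u v, u \in A -> v \in A ->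
    (E s u w -> E s w v -> u != v -> E s u v) /\
    (E s u v -> E (~~ s) v w -> E s u w).

(** * Mountains and hills given by vertex sequences *)

Section Obstructions.
Hypothesis C3 : cond_C3 G.

(** The passage to the induced subgraph on [x :: L] is made here once, so that later arguments stay
    inside [G]. A nonempty [m] gives the path its three vertices. *)
Lemma no_mountain s p m q x :
  induced_path (E (~~ s)) p (rcons m q) -> 0 < size m ->
  {in p :: rcons m q &, forall u v, E s u v = false} ->
  x \notin p :: rcons m q ->
  {in p :: rcons m q, forall v, E (~~ s) x v = false} ->
  {in m, forall v, E s x v} -> E s x p = false -> E s x q = false -> False.
Proof.
move=> pmq m0 noE xN noEx xm xp xq.
have uL := induced_path_uniq (sedge_irr G (~~ s)) pmq.
set L := p :: rcons m q in noE xN noEx uL.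
pose n := size L; pose S := [set z in x :: L].
have xS : x \in S by rewrite !inE eqxx.
have LS (i : 'I_n) : nth p L i \in L by rewrite mem_nth.
have vS (i : 'I_n) : nth p L i \in S by rewrite inE in_cons LS orbT.
pose v (i : 'I_n) : {z | z \in S} := exist _ (nth p L i) (vS i).
have [noM _] := C3 S; apply: noM.
exists s, n, v, (exist _ x xS); split.
- by rewrite /n /= size_rcons.
- split=> [i j /(congr1 val)/eqP /= | i].
    by rewrite nth_uniq // => /eqP ij; apply: val_inj.
  rewrite -val_eqE /=; apply: contraNneq xN => <-; exact: LS.
- case=> z zS; have := zS; rewrite inE in_cons => /predU1P[zx | zL].
    by left; apply: val_inj.
  right; have zn : index z L < n by rewrite index_mem.
  by exists (Ordinal zn); apply: val_inj; rewrite /= nth_index.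
- split=> i j /=; last by rewrite noE ?LS.
  rewrite (induced_path_nth (sedge_sym G _) (sedge_irr G _) p pmq) //.
    by have := ltn_ord i.
  by have := ltn_ord j.
- split=> i /=; last by rewrite noEx ?LS.
  case: i => [[|i] /= hi] //.
  rewrite /n /= size_rcons !ltnS in hi *.
  rewrite nth_rcons; case: ltngtP hi => // im _; by rewrite xm ?mem_nth.
Qed.

Lemma no_hill s p m q x1 x2 :
  induced_path (E (~~ s)) p (rcons m q) ->
  {in p :: rcons m q &, forall u v, E s u v = false} ->
  {in p :: rcons m q, forall v, E (~~ s) x1 v = false /\ E (~~ s) x2 v = false} ->
  x1 \notin p :: rcons m q -> x2 \notin p :: rcons m q -> E s x1 x2 ->
  {in p :: m, forall v, E s x1 v} -> {in rcons m q, forall v, E s x2 v} ->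
  E s x1 q = false -> E s x2 p = false -> False.
Proof.
move=> pmq noE noEx x1N x2N x12 x1m x2m x1q x2p.
have uL := induced_path_uniq (sedge_irr G (~~ s)) pmq.
set L := p :: rcons m q in noE x1N x2N noEx uL.
pose n := size L; pose S := [set z in [:: x1, x2 & L]].
have x1S : x1 \in S by rewrite !inE eqxx.
have x2S : x2 \in S by rewrite !inE eqxx orbT.
have LS (i : 'I_n) : nth p L i \in L by rewrite mem_nth.
have vS (i : 'I_n) : nth p L i \in S by rewrite inE !in_cons -in_cons LS !orbT.
pose v (i : 'I_n) : {z | z \in S} := exist _ (nth p L i) (vS i).
have [_ noH] := C3 S; apply: noH.
exists s, n, v, (exist _ x1 x1S), (exist _ x2 x2S); split.
- by rewrite /n /= size_rcons.
- split=> [i j /(congr1 val)/eqP /= | i | i |].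
  + by rewrite nth_uniq // => /eqP ij; apply: val_inj.
  + rewrite -val_eqE /=; apply: contraNneq x1N => <-; exact: LS.
  + rewrite -val_eqE /=; apply: contraNneq x2N => <-; exact: LS.
  + by rewrite -val_eqE /=; apply: contraTneq x12 => ->; rewrite sedge_irr.
- case=> z zS; have := zS; rewrite inE => /[!in_cons] /or3P[/eqP zx | /eqP zx | zL].
  + by left; apply: val_inj.
  + by right; left; apply: val_inj.
  right; right; have zn : index z L < n by rewrite index_mem.
  by exists (Ordinal zn); apply: val_inj; rewrite /= nth_index.
- split=> i j /=; last by rewrite noE ?LS.
  rewrite (induced_path_nth (sedge_sym G _) (sedge_irr G _) p pmq) //.
    by have := ltn_ord i.
  by have := ltn_ord j.
- split=> [// | i | i | i] /=; last by apply: noEx; apply: LS.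
    case: i => [i hi] /=; rewrite /n /= size_rcons ltnS in hi *.
    rewrite -[L]/(rcons (p :: m) q) nth_rcons ltnS.
    case: ltngtP hi => // im _; by rewrite x1m ?mem_nth.
  case: i => [[|i] /= hi] //.
  by rewrite x2m // mem_nth.
Qed.

End Obstructions.

(** * Sufficiency: a vertex that may come last in [A] *)

Section Elimination.
Hypotheses (C2 : cond_C2 G) (C3 : cond_C3 G).
Hypothesis chordalG : chordal (underlying G).
Variable A : {set V}.

Let Esym := sedge_sym G.
Let Eirr := sedge_irr G.

(** The edges at [v] have different signs, and so do those at [w]; this separates every pair except
    [u], [x]. *)
Lemma C2_uniq s u v w x :
  E (~~ s) v w -> E s v u -> E s w x -> u != x -> uniq [:: u; v; w; x].
Proof.
move=> vw vu wx ux; rewrite /= !inE !negb_or ux !andbT /=.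
have neq a b t c : E t c a -> E t c b = false -> a != b.
  by move=> ca; apply: contraFneq => <-.
have vwF : E s v w = false by rewrite -[s]negbK sedge_disjF.
have wvF : E s w v = false by rewrite Esym.
have uv := neq _ _ _ _ vu (Eirr _ _); have uw := neq _ _ _ _ vu vwF.
have wv := neq _ _ _ _ vw (Eirr _ _); have xv := neq _ _ _ _ wx wvF.
have xw := neq _ _ _ _ wx (Eirr _ _).
by rewrite uv uw eq_sym wv [v == x]eq_sym xv eq_sym xw.
Qed.

(** The edge [ux] occurs in both alternatives of (C2). *)
Lemma C2_complete s v w u x :
  E (~~ s) v w -> E s v u -> E s w x -> u != x -> E s u x.
Proof.
move=> vw vu wx ux.
have uv : E s u v by rewrite Esym.
by case: (C2 (C2_uniq vw vu wx ux) uv vw wx) => -[].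
Qed.

Definition nb s v := [set u in A | E s v u].

Lemma in_nb s v u : u \in A -> (u \in nb s v) = E s v u.
Proof. by rewrite inE => ->. Qed.

Lemma edge_of_nb s v u : u \in nb s v -> E s v u.
Proof. by rewrite inE => /andP[]. Qed.

(** If [u] is an [s]-neighbour of [v] only and [x] of [w] only, (C2) fails on [u, v, w, x]: one
    alternative contains [uw], the other [vx]. *)
Lemma nb_nested s v w : E (~~ s) v w ->
  (nb s v \subset nb s w) || (nb s w \subset nb s v).
Proof.
move=> vw; apply: contraT; rewrite negb_or => /andP[/subsetPn[u + uw] /subsetPn[x + xv]].
rewrite !inE => /andP[uA vu] /andP[xA wx].
have ux : u != x by apply: contraNneq xv => <-; rewrite in_nb.
have uv : E s u v by rewrite Esym.
case: (C2 (C2_uniq vw vu wx ux) uv vw wx) => -[uw' vx].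
  by rewrite in_nb // Esym uw' in uw.
by rewrite in_nb // vx in xv.
Qed.

Lemma boundary_clique s (T X : {set V}) :
    T \subset A ->
    {in T &, forall t t',
      connect [rel u v | [&& u \in T, v \in T & E (~~ s) u v]] t t'} ->
    {in T, forall t, nb s t = X} ->
    {in T, forall t r, r \in A -> r \notin T -> E (~~ s) t r ->
      nb s r \proper X} ->
  forall p q tp tq, p \in A -> q \in A -> p \notin T -> q \notin T ->
    tp \in T -> tq \in T -> E (~~ s) tp p -> E (~~ s) tq q -> p != q ->
  E (~~ s) p q.
Proof.
move=> TA con TX out p q tp tq pA qA pT qT tpT tqT tpp tqq pq.
apply: contraT => npq; exfalso.
have ptp : E (~~ s) p tp by rewrite Esym.
have qtq : E (~~ s) q tq by rewrite Esym.
have XE t x : t \in T -> x \in X -> E s t x.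
  by move=> tT; rewrite -(TX t tT) => /edge_of_nb.
have XF t x : t \in T -> E (~~ s) t x -> x \notin X.
  move=> tT tx; apply/negP => /(XE t x tT) tx'.
  by rewrite (sedge_disjF tx') in tx.
have pX := out _ tpT p pA pT tpp.
have qX := out _ tqT q qA qT tqq.
have [m pmq mT] := joining_induced_path (Eirr (~~ s)) pq tpT qT ptp tqq (con _ _ tpT tqT).
have LP z : z \in p :: rcons m q -> [\/ z = p, z = q | z \in T].
  rewrite in_cons mem_rcons in_cons => /or3P[/eqP | /eqP | /mT]; by constructor.
have LX z : z \in p :: rcons m q -> z \in A /\ z \notin X.
  case/LP => [-> | -> | zT]; [by split; last exact: (XF tp) | by split; last exact: (XF tq) |].
  split; first exact: (subsetP TA).
  by rewrite -(TX z zT) inE Eirr andbF.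
(* Every vertex of the path has its [s]-neighbours in [A] inside [X], and the path avoids [X]. *)
have noE : {in p :: rcons m q &, forall u v, E s u v = false}.
  move=> u v uL vL; have [vA vX] := LX v vL.
  apply: contraNF vX; rewrite -(in_nb s u vA).
  case: (LP u uL) => [-> | -> | uT]; last by rewrite TX.
    by apply/subsetP; exact: proper_sub.
  by apply/subsetP; exact: proper_sub.
have XL x : x \in X -> x \notin p :: rcons m q.
  by move=> xX; apply/negP => /LX[_]; rewrite xX.
(* If [xp] had sign [~~ s], then (C2) along [p, x, tq, q], whose middle edge has sign [s], would
   give [pq] the sign [~~ s]; likewise for [q]. *)
have noEx x : x \in X -> {in p :: rcons m q, forall v, E (~~ s) x v = false}.
  move=> xX v /LP[-> | -> | vT].
  - apply/negP => xp; case/negP: npq.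
    have xtq : E (~~ ~~ s) x tq by rewrite negbK Esym XE.
    exact: (C2_complete xtq xp tqq).
  - apply/negP => xq; case/negP: npq; rewrite Esym.
    have xtp : E (~~ ~~ s) x tp by rewrite negbK Esym XE.
    by apply: (C2_complete xtp xq tpp); rewrite eq_sym.
  - by rewrite Esym sedge_disjF // XE.
have m0 : 0 < size m by case: m pmq {mT LP LX noE XL noEx} => //=; rewrite (negbTE npq).
have XA x : x \in X -> x \in A by rewrite -(TX tp tpT) inE => /andP[].
have mX x : x \in X -> {in m, forall v, E s x v}.
  by move=> xX v /mT vT; rewrite Esym XE.
(* A vertex of [X] that is an [s]-neighbour of neither end is the top of a mountain over the
   path. *)
case: (boolP [exists x in X, (x \notin nb s p) && (x \notin nb s q)]).
  case/exists_inP => x xX /andP[xp xq].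
  apply: (no_mountain C3 pmq m0 noE (XL x xX) (noEx x xX) (mX x xX)).
    by rewrite Esym -in_nb ?XA //; apply: negbTE.
  by rewrite Esym -in_nb ?XA //; apply: negbTE.
rewrite negb_exists_in => /forall_inP cover.
(* Properness gives [x1] in [X] missed by [q] and [x2] in [X] missed by [p]. By [cover] each is
   joined to the other end, so they differ, and (C2) across the edge [p tp] makes them adjacent: a
   hill. *)
have [_ [x1 x1X x1q]] := properP qX; have [_ [x2 x2X x2p]] := properP pX.
have x1p : x1 \in nb s p by have := cover x1 x1X; rewrite x1q andbT negbK.
have x2q : x2 \in nb s q by have := cover x2 x2X; rewrite x2p negbK.
have x12 : x1 != x2 by apply: contraNneq x2p => <-.
apply: (@no_hill C3 s p m q x1 x2) => //; try exact: XL.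
- by move=> v vL; rewrite !noEx.
- exact: (C2_complete ptp (edge_of_nb x1p) (XE _ _ tpT x2X)).
- by move=> v; rewrite in_cons => /predU1P[-> | /mX->//]; rewrite Esym (edge_of_nb x1p).
- move=> v; rewrite mem_rcons in_cons => /predU1P[-> | /mX->//].
  by rewrite Esym (edge_of_nb x2q).
- by rewrite Esym -in_nb ?XA //; apply: negbTE.
- by rewrite Esym -in_nb ?XA //; apply: negbTE.
Qed.

(* A vertex [w] of [A] fails condition (E2) exactly when some edge at [w] has
   another end that is not [dominated] by [w]. *)
Definition dominated s v u := E s v u && (nb (~~ s) v \subset nb (~~ s) u).

Definition arc := [rel v u | [&& v \in A, u \in A & dominated true v u || dominated false v u]].

Lemma dominated_arc s v u : v \in A -> u \in A -> dominated s v u -> arc v u.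
Proof. by move=> vA uA vu; rewrite /= vA uA; case: s vu => ->; rewrite ?orbT. Qed.

Lemma arcP s v u : arc v u -> [/\ v \in A, u \in A & dominated s v u \/ dominated (~~ s) v u].
Proof. by case: s => /and3P[vA uA /orP[]]; split=> //; [left|right|right|left]. Qed.

(* Inside a closed walk of [arc], arcs of both signs would make [nb] grow
   strictly: a mixed pair of consecutive arcs merges into a strict one. *)
Lemma dominated_mixed s v u t : v \in A -> u \in A -> dominated s v u -> dominated (~~ s) u t ->
  dominated s v t /\ nb (~~ s) v \proper nb (~~ s) t.
Proof.
move=> vA uA /andP[vu _] /andP[ut sub]; rewrite negbK in sub.
have vt : E s v t.
  by rewrite Esym -in_nb //; apply: (subsetP sub); rewrite in_nb // Esym.
have pr : nb (~~ s) v \proper nb (~~ s) t.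
  have ut' : u \in nb (~~ s) t by rewrite in_nb // Esym.
  have uv' : u \notin nb (~~ s) v by rewrite in_nb // sedge_disjF.
  have vt' : E (~~ ~~ s) v t by rewrite negbK.
  rewrite properE; have [->|sub'] := orP (nb_nested vt').
    by apply/subsetPn; exists u.
  by rewrite (subsetP sub' _ ut') in uv'.
by split=> //; rewrite /dominated vt proper_sub.
Qed.

(** An invariant carried along the walk. After an arc of sign [s], its source replaces [v] and both
    bounds persist by inclusion. An arc of the other sign merges with the arc from [v] into a strict
    one, so the new endpoint has at least [k.+1] neighbours; this is where [l <= k.+1] enters. *)
Lemma dominated_chain s k l z z' : l <= k.+1 -> connect arc z z' ->
  (exists v, [/\ v \in A, dominated s v z, k <= #|nb (~~ s) v| & l <= #|nb (~~ s) z|]) ->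
  exists v, [/\ v \in A, dominated s v z', k <= #|nb (~~ s) v| & l <= #|nb (~~ s) z'|].
Proof.
move=> lk /connectP[p + ->]; elim: p z => //= y p IHp z.
case/andP=> /(arcP s)[zA yA zy] yp [v [vA vz kv lz]].
apply: IHp yp _; case: zy => zy.
  exists z; have /andP[_ /subset_leq_card zyn] := zy.
  have /andP[_ /subset_leq_card vzn] := vz.
  by split=> //; [exact: leq_trans vzn | exact: leq_trans zyn].
have [vy /proper_card vyn] := dominated_mixed vA zA vz zy.
by exists v; split=> //; apply: leq_trans lk _; apply: leq_ltn_trans vyn.
Qed.

(** Let [k] be the number of [~~ s]-neighbours of [v]. The invariant holds up to [t] with [l = 0];
    the arc from [t] to [w] merges strictly and raises [l] to [k.+1]. Carried back to [v], this
    gives [k < k]. *)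
Lemma dominated_acyclic s v u t w : v \in A -> u \in A -> w \in A -> t \in A ->
  dominated s v u -> connect arc u t -> dominated (~~ s) t w -> connect arc w v -> False.
Proof.
move=> vA uA wA tA vu ut tw wv; set k := #|nb (~~ s) v|.
have [|v1 [v1A v1t kv1 _]] := dominated_chain (leq0n k.+1) ut (s := s).
  by exists v; split.
have [v1w /proper_card v1wn] := dominated_mixed v1A tA v1t tw.
have [|v2 [_ _ _]] := dominated_chain (leqnn k.+1) wv (s := s).
  by exists v1; split=> //; apply: leq_ltn_trans v1wn.
by rewrite ltnn.
Qed.

Lemma exists_signed_simplicial : A != set0 ->
  exists2 w, w \in A & signed_simplicial A w.
Proof.
case/set0Pn => a0 a0A.
(* [v0] reaches as few vertices as possible, so any vertex it reaches has the same reachable set and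
   reaches [v0] back. *)
case: (arg_minnP (fun v => #|[set u | connect arc v u]|) a0A) => v0 v0A min.
(* [T] is a terminal strongly connected component of [arc]. *)
set T := [set u | connect arc v0 u] in min.
have v0T : v0 \in T by rewrite inE connect0.
have TA : {subset T <= A}.
  move=> u; rewrite inE => /connectP[p + ->].
  by elim: p (v0) v0A {v0T T min} => //= y p IHp x _ /andP[/and3P[_ yA _] /IHp]; apply.
have Tarc t u : t \in T -> connect arc t u -> u \in T.
  by rewrite !inE => v0t tu; apply: connect_trans tu.
have Tback t t' : t \in T -> t' \in T -> connect arc t t'.
  move=> tT; rewrite inE => v0t'; apply: connect_trans v0t'.
  have sub : [set u | connect arc t u] \subset T.
    by apply/subsetP => u; rewrite inE; apply: Tarc.
  have /eqP eqT : [set u | connect arc t u] == T.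
    by rewrite eqEcard sub; apply: min; apply: TA.
  by have := v0T; rewrite -eqT inE.
(* Arcs of both signs leaving [T] would end in [T], by terminality, and so lie on a common closed
   walk. *)
have [s noarc] : exists s, forall t w, t \in T -> w \in A -> ~~ dominated s t w.
  case: (boolP [exists t in T, [exists w in A, dominated true t w]]).
    case/exists_inP => v vT /exists_inP[u uA vu]; exists false => t w tT wA.
    have vA := TA v vT; have tA := TA t tT.
    apply/negP => tw; apply: (dominated_acyclic vA uA wA tA vu _ tw).
      apply: Tback tT; apply: Tarc vT _.
      by apply: connect1; exact: dominated_arc vu.
    apply: Tback vT; apply: Tarc tT _.
    by apply: connect1; exact: dominated_arc tw.
  rewrite negb_exists_in => /forall_inP no; exists true => t w tT wA.
  by have := no t tT; rewrite negb_exists_in => /forall_inP/(_ w wA).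
have arcT t t' : t \in T -> arc t t' -> t' \in T /\ dominated (~~ s) t t'.
  move=> tT tt'; split; first by apply: Tarc tT _; apply: connect1.
  by case/(arcP s): tt' => _ t'A [|//]; rewrite (negbTE (noarc _ _ tT t'A)).
(* Arcs of sign [~~ s] can only enlarge [nb s]; going back and forth in [T] makes it constant. *)
have Tpath t t' : t \in T -> connect arc t t' ->
    connect [rel u v | [&& u \in T, v \in T & E (~~ s) u v]] t t' /\
    nb s t \subset nb s t'.
  move=> tT /connectP[p + ->]; elim: p t tT => //= y p IHp t tT.
  case/andP=> /(arcT _ _ tT)[yT /andP[ty sub]] /(IHp y yT)[con sub'].
  split; first by apply: connect_trans con; apply: connect1; rewrite /= tT yT ty.
  by apply: subset_trans sub'; rewrite negbK in sub.
have Tcon : {in T &, forall t t',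
    connect [rel u v | [&& u \in T, v \in T & E (~~ s) u v]] t t'}.
  by move=> t t' tT t'T; case: (Tpath t t' tT (Tback _ _ tT t'T)).
set X := nb s v0.
have TX : {in T, forall t, nb s t = X}.
  move=> t tT; apply/eqP; rewrite eqEsubset.
  by have [_ ->] := Tpath _ _ tT (Tback _ _ tT v0T); case: (Tpath _ _ v0T (Tback _ _ v0T tT)).
(* The edge [ty] is not an arc leaving [t], so nestedness must hold strictly the other way. The same
   reasoning gives [out], as an arc from [t] cannot leave [T]. *)
have low t y : t \in T -> y \in A -> E s t y -> nb (~~ s) y \proper nb (~~ s) t.
  move=> tT yA ty; have := noarc t y tT yA; rewrite /dominated ty /= => nsub.
  have ty' : E (~~ ~~ s) t y by rewrite negbK.
  by rewrite properE nsub andbT; have := nb_nested ty'; rewrite (negbTE nsub).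
have out : {in T, forall t r, r \in A -> r \notin T -> E (~~ s) t r ->
    nb s r \proper X}.
  move=> t tT r rA rT tr; have tA := TA t tT; have := nb_nested tr; rewrite -(TX t tT) properE.
  have nsub : ~~ (nb s t \subset nb s r).
    apply: contra rT => sub; apply: Tarc tT _; apply: connect1.
    by apply: (@dominated_arc (~~ s)); rewrite ?tA // /dominated tr negbK.
  by rewrite (negbTE nsub) => /= ->.
have sTA : T \subset A by apply/subsetP.
pose Q := [set q in A :\: T | [exists t in T, E (~~ s) t q]].
have QP q : q \in Q -> [/\ q \in A, q \notin T & exists2 t, t \in T & E (~~ s) t q].
  by rewrite {1}/Q inE in_setD => /andP[/andP[qT qA] /exists_inP[t tT tq]]; split=> //; exists t.
have clQ : {in Q &, forall p q, p != q -> E (~~ s) p q}.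
  move=> p q /QP[pA pT [tp tpT tpp]] /QP[qA qT [tq tqT tqq]].
  exact: (boundary_clique sTA Tcon TX out pA qA pT qT tpT tqT).
have QW : Q \proper T :|: Q.
  rewrite properE subsetUr; apply/subsetPn; exists v0; first by rewrite inE v0T.
  by apply/negP => /QP[_]; rewrite v0T.
have [|v vTQ vsim] := chordal_simplicial chordalG QW.
  by move=> p q pQ qQ pq; rewrite (adj_underlyingE s) clQ ?orbT.
have vT : v \in T by move: vTQ; rewrite inE in_setU => /andP[/negbTE->]; rewrite orbF.
have vA := TA v vT.
have nbW u : u \in A -> E (~~ s) v u -> u \in T :|: Q.
  move=> uA vu; rewrite in_setU; case: (boolP (u \in T)) => //= uT.
  by rewrite /Q inE in_setD uT uA; apply/exists_inP; exists v.
have noTX t u : t \in T -> u \in A -> E (~~ s) v u -> E s t u = false.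
  move=> tT uA vu; apply/negP; rewrite -in_nb // TX // -(TX v vT) in_nb // => vu'.
  by rewrite (sedge_disjF vu') in vu.
(* Chordality gives the edge; its sign is fixed by [noTX] if an end lies in [T], and by the clique
   [Q] otherwise. *)
have cl_ns u w : u \in A -> w \in A -> E (~~ s) v u -> E (~~ s) v w -> u != w -> E (~~ s) u w.
  move=> uA wA vu vw uw.
  have := vsim u w (nbW u uA vu) (nbW w wA vw).
  rewrite !(adj_underlyingE s) vu vw !orbT => /(_ isT isT uw)/orP[uws|//].
  have [uT|uT] := boolP (u \in T); first by rewrite (noTX u w) in uws.
  have [wT|wT] := boolP (w \in T); first by rewrite Esym (noTX w u) in uws.
  apply: clQ uw; [have := nbW u uA vu | have := nbW w wA vw].
    by rewrite in_setU (negbTE uT).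
  by rewrite in_setU (negbTE wT).
have low' y : y \in A -> E (~~ s) v y -> nb s y \subset nb s v.
  move=> yA vy; rewrite (TX v vT); have [yT|yT] := boolP (y \in T).
    by rewrite TX.
  exact/proper_sub/(out v vT).
(* (E1) for [s] is the boundary lemma with the signs exchanged, at [[set v]]. *)
have cl_s u w : u \in A -> w \in A -> E s v u -> E s v w -> u != w -> E s u w.
  move=> uA wA vu vw uw; rewrite -[s]negbK.
  apply: (@boundary_clique (~~ s) [set v] (nb (~~ s) v) _ _ _ _ u w v v) => //.
  - by rewrite sub1set.
  - by move=> t t' /set1P-> /set1P->; apply: connect0.
  - by move=> t /set1P->.
  - by move=> t /set1P-> r rA _; rewrite negbK; apply: low.
  - by rewrite inE; apply: contraTneq vu => ->; rewrite Eirr.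
  - by rewrite inE; apply: contraTneq vw => ->; rewrite Eirr.
  - by rewrite inE.
  - by rewrite inE.
  - by rewrite negbK.
  - by rewrite negbK.
exists v => // r u w uA wA.
have [->|->] : r = s \/ r = ~~ s by case: (r) (s) => [] []; [left|right|right|left].
  split=> [|uw wv]; first by rewrite Esym; exact: cl_s.
  by rewrite Esym -in_nb //; apply: (subsetP (low' w wA _)); rewrite ?in_nb // Esym.
split=> [|uw]; first by rewrite Esym; exact: cl_ns.
rewrite negbK => wv.
have vw : E s v w by rewrite Esym.
rewrite Esym -in_nb //; apply: (subsetP (proper_sub (low v w vT wA vw))).
by rewrite in_nb // Esym.
Qed.

End Elimination.

End Signed.

(** * Elimination orderings, and necessity of (C2) and (C3) *)

Section Orderings.
Variables (V : finType) (G : signed_graph V).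

Local Notation E := (sedge G).

(** The witness is the vertex of [A] with the largest label. *)
Lemma SEO_signed_simplicial (A : {set V}) : signed_eliminable G -> A != set0 ->
  exists2 w, w \in A & signed_simplicial G A w.
Proof.
case=> nu [/bij_inj nu_inj SEO] /set0Pn[x0 x0A].
case: (arg_maxnP (fun x => nu x : nat) x0A) => w wA max; exists w => //.
have lt u : u \in A -> u != w -> nu u < nu w.
  move=> uA uw; rewrite ltn_neqAle; apply/andP; split; last exact: max.
  by rewrite val_eqE (inj_eq nu_inj).
have neq s x y : E s x y -> x != y.
  by apply: contraTneq => ->; rewrite sedge_irr.
move=> s u v uA vA; split=> [uw wv uv | uv vw].
  have [uw' wv'] := (neq _ _ _ uw, neq _ _ _ wv).
  have uni : uniq [:: u; v; w].
    by rewrite /= !inE negb_or uv uw' [v == w]eq_sym wv'.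
  have vw' : v != w by rewrite eq_sym.
  by have [/(_ uw wv)] := SEO u v w uni (lt _ uA uw') (lt _ vA vw') s.
have [uv' vw'] := (neq _ _ _ uv, neq _ _ _ vw).
have uw' : u != w.
  by apply: contraTneq vw => <-; rewrite sedge_sym sedge_disjF.
have uni : uniq [:: u; v; w] by rewrite /= !inE negb_or uv' uw' vw'.
by have [_ /(_ uv vw)] := SEO u v w uni (lt _ uA uw') (lt _ vA vw') s.
Qed.

Lemma signed_simplicial_SEO :
  (forall A : {set V}, A != set0 -> exists2 w, w \in A & signed_simplicial G A w) ->
  signed_eliminable G.
Proof.
move=> exs.
(* Vertices that may come last are peeled off one by one; the list starts with the last vertex of
   the ordering, hence [rev_ord] below. *)
have [s [us sT ord]] : exists s, [/\ uniq s, s =i [set: V] &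
    forall w u v, w \in s -> index w s < index u s -> index w s < index v s ->
      u \in s -> v \in s ->
      forall t, (E t u w -> E t w v -> u != v -> E t u v) /\
                (E t u v -> E (~~ t) v w -> E t u w)].
  move: [set: V] => A; have [n] := ubnP #|A|; elim: n => // n IHn in A * => An.
  have [A0 | /exs[a aA simp]] := eqVneq A set0.
    by exists [::]; split=> // x; rewrite A0 inE.
  have [|s [us sA ord]] := IHn (A :\ a).
    by move: An; rewrite (cardsD1 a A) aA.
  exists (a :: s); split.
  - by rewrite /= us andbT sA !inE eqxx.
  - by move=> x; rewrite in_cons sA !inE; case: eqVneq => //= ->.
  have sA' x : x \in a :: s -> x \in A.
    by rewrite in_cons sA !inE => /predU1P[-> // | /andP[]].
  move=> w u v; rewrite /=; case: (eqVneq a w) => [<- | aw].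
    by move=> _ _ _ us' vs' t; apply: simp; apply: sA'.
  rewrite !in_cons eq_sym (negbTE aw) /=.
  case: (eqVneq a u) => //= au; case: (eqVneq a v) => //= av ws wu wv us' vs'.
  by apply: ord => //; move: us' vs'; rewrite ![_ == a]eq_sym (negbTE au) (negbTE av).
have sz : size s = #|V| by rewrite -(card_uniqP us) (eq_card sT) cardsT.
have xs x : x \in s by rewrite sT inE.
have idx x : index x s < #|V| by rewrite -sz index_mem.
exists (fun x => rev_ord (Ordinal (idx x))); split.
  apply: inj_card_bij; last by rewrite card_ord.
  move=> x y /rev_ord_inj/(congr1 val) /= xy.
  by rewrite -(nth_index x (xs x)) xy nth_index.
have lt x y : rev_ord (Ordinal (idx x)) < rev_ord (Ordinal (idx y)) -> index y s < index x s.
  by move=> /=; have := idx x; have := idx y; lia.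
move=> u v w /=; rewrite !inE negb_or => /and3P[/andP[uv _] _ _] uw vw t.
have [E1 E2] := ord w u v (xs w) (lt _ _ uw) (lt _ _ vw) (xs u) (xs v) t.
by split=> // ? ?; apply: E1.
Qed.

Section Necessity.
Hypothesis SE : signed_eliminable G.

Lemma SEO_C2 : cond_C2 G.
Proof.
move=> s u v w x uni uv vw wx.
have [|z zA simp] := @SEO_signed_simplicial [set u; v; w; x] SE.
  by apply/set0Pn; exists u; rewrite !inE eqxx.
have uA : u \in [set u; v; w; x] by rewrite !inE eqxx.
have vA : v \in [set u; v; w; x] by rewrite !inE eqxx !orbT.
have wA : w \in [set u; v; w; x] by rewrite !inE eqxx !orbT.
have xA : x \in [set u; v; w; x] by rewrite !inE eqxx !orbT.
have vu : E s v u by rewrite sedge_sym.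
have wv : E (~~ s) w v by rewrite sedge_sym.
have xw : E s x w by rewrite sedge_sym.
have ux : u != x by move: uni; rewrite /= !inE !negb_or => /andP[/and3P[]].
have vx : v != x by move: uni; rewrite /= !inE !negb_or => /and3P[_ /andP[]].
have uw : u != w by move: uni; rewrite /= !inE !negb_or => /andP[/and3P[]].
(* The case is chosen by which of the four vertices comes last: [u] or [v] leads to the second
   alternative, [w] or [x] to the first. *)
move: zA; rewrite !inE -!orbA => /or4P[] /eqP zE; subst z.
- have [_ /(_ wv)] := simp (~~ s) w v wA vA; rewrite negbK => /(_ vu) wu.
  have [_ /(_ xw wu) xu] := simp s x w xA wA.
  have [/(_ vu) + _] := simp s v x vA xA; rewrite [E s u x]sedge_sym => /(_ xu vx) vx'.
  by right.
- have [_ /(_ xw wv) xv] := simp s x w xA wA.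
  have [/(_ uv) + _] := simp s u x uA xA; rewrite [E s v x]sedge_sym => /(_ xv ux) ux'.
  by right; split; rewrite // sedge_sym.
- have [_ /(_ uv vw) uw'] := simp s u v uA vA.
  have [/(_ uw' wx ux) ux' _] := simp s u x uA xA.
  by left.
- have [_ /(_ vw)] := simp (~~ s) v w vA wA; rewrite negbK => /(_ wx) vx'.
  have [_ /(_ uv vx') ux'] := simp s u v uA vA.
  have [/(_ ux') + _] := simp s u w uA wA; rewrite [E s x w]sedge_sym => /(_ wx uw) uw'.
  by left.
Qed.

Lemma SEO_induced (S : {set V}) (x : {x | x \in S}) : exists z : {x | x \in S},
  forall s (u v : {x | x \in S}), let E' := sedge (induced S G) in
    (E' s u z -> E' s z v -> u != v -> E' s u v) /\
    (E' s u v -> E' (~~ s) v z -> E' s u z).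
Proof.
have [|z zS simp] := @SEO_signed_simplicial S SE.
  by apply/set0Pn; exists (val x); exact: valP.
exists (exist _ z zS) => s u v /=; rewrite -val_eqE.
exact: simp (valP u) (valP v).
Qed.

Lemma SEO_C3 : cond_C3 G.
Proof.
move=> S; split.
- case=> s [n [v [w [n3 [v_inj _] cover [Evv _] [Ewv Ewv']]]]].
  have [z simp] := SEO_induced w; set H := induced S G in simp Evv Ewv Ewv'.
  have E1 i j : sedge H (~~ s) (v i) z -> sedge H (~~ s) z (v j) -> i != j ->
      sedge H (~~ s) (v i) (v j).
    by move=> iz zj ij; have [/(_ iz zj)] := simp (~~ s) (v i) (v j); rewrite (inj_eq v_inj) => /(_ ij).
  (* If the top [w] is last, (E2) on the first path edge joins [w] to the end of the path with sign
     [~~ s]. *)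
  have [zw | [i zi]] := cover z; subst z.
    have lt0 : 0 < n by lia.
    have lt1 : 1 < n by lia.
    have [_] := simp (~~ s) (v (Ordinal lt0)) (v (Ordinal lt1)).
    rewrite negbK Evv [sedge H s _ w]sedge_sym Ewv [sedge H _ _ w]sedge_sym Ewv' /= n3.
    by move/(_ isT isT).
  have end_absurd j : sedge H s w (v j) -> sedge H (~~ s) (v j) (v i) ->
      sedge H s w (v i).
    by move=> wj ji; have [_ /(_ wj ji)] := simp s w (v j).
  have lti := ltn_ord i; have lt2 : i.-1 < n by lia.
  (* An end of the path coming last would be joined to [w] by (E2); an inner vertex coming last
     would have its two path neighbours joined by (E1). *)
  case: (ltnP i.+1 n) => [lt3 | ge]; last first.
    have := end_absurd (Ordinal lt2); rewrite !Ewv Evv /=; lia.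
  case: (posnP i) => [i0 | i_gt0].
    have := end_absurd (Ordinal lt3); rewrite !Ewv Evv /=; lia.
  have := E1 (Ordinal lt2) (Ordinal lt3); rewrite !Evv -val_eqE /=; lia.
case=> s [n [v [w1 [w2 [n2 [v_inj _ _ _] cover [Evv _] [Ew12 Ew1 Ew2 Ew']]]]]].
have [z simp] := SEO_induced w1; set H := induced S G in simp Evv Ew12 Ew1 Ew2 Ew'.
have E1 i j : sedge H (~~ s) (v i) z -> sedge H (~~ s) z (v j) -> i != j ->
    sedge H (~~ s) (v i) (v j).
  by move=> iz zj ij; have [/(_ iz zj)] := simp (~~ s) (v i) (v j); rewrite (inj_eq v_inj) => /(_ ij).
have lt0 : 0 < n by lia.
have lt1 : 1 < n by lia.
have ltn1 : n.-1 < n by lia.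
have ltn2 : n.-2 < n by lia.
have E2 i j : sedge H (~~ s) (v i) (v j) -> sedge H s z (v j) -> sedge H (~~ s) z (v i).
  move=> ij jz; have [_ /(_ ij)] := simp (~~ s) (v i) (v j).
  by rewrite negbK ![sedge H _ _ z]sedge_sym; apply.
(* As for the mountain, but each top misses one end of the path: [w1] handles the final vertex and
   [w2] the initial one. *)
have [zw | [zw | [i zi]]] := cover z; subst z.
- have [F _] := Ew' (Ordinal ltn1).
  have := E2 (Ordinal ltn1) (Ordinal ltn2); rewrite F Evv Ew1 /=; lia.
- have [_ F] := Ew' (Ordinal lt0).
  have := E2 (Ordinal lt0) (Ordinal lt1); rewrite F Evv Ew2 /=; lia.
have end_absurd w j : sedge H s w (v j) -> sedge H (~~ s) (v j) (v i) ->
    sedge H s w (v i).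
  by move=> wj ji; have [_ /(_ wj ji)] := simp s w (v j).
have lti := ltn_ord i; have lt2 : i.-1 < n by lia.
case: (ltnP i.+1 n) => [lt3 | ge]; last first.
  have := end_absurd w1 (Ordinal lt2); rewrite !Ew1 Evv /=; lia.
case: (posnP i) => [i0 | i_gt0].
  have := end_absurd w2 (Ordinal lt3); rewrite !Ew2 Evv /=; lia.
have := E1 (Ordinal lt2) (Ordinal lt3); rewrite !Evv -val_eqE /=; lia.
Qed.

End Necessity.
End Orderings.

Theorem proposition6p2 (V : finType) (G : signed_graph V)
    (chordalG : chordal (underlying G)) :
  signed_eliminable G <-> cond_C2 G /\ cond_C3 G.
Proof.
split=> [SE | [C2 C3]]; first by split; [exact: SEO_C2 | exact: SEO_C3].
apply: signed_simplicial_SEO => A; exact: exists_signed_simplicial.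
Qed.
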